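(* Let $n\ge 1$ and let $\mathfrak{g}_{\mathbb{R}\mathrm{H}^{2n}}$ be the real Lie algebra with basis $\{e_1,\ldots,e_{2n}\}$ and bracket relations $[e_1,e_k]=e_k$ for $k=2,\ldots,2n$. The action of $\mathbb{R}^\times\mathrm{Aut}(\mathfrak{g}_{\mathbb{R}\mathrm{H}^{2n}})$ on $\Omega(\mathfrak{g}_{\mathbb{R}\mathrm{H}^{2n}})$ is transitive. A set of representatives for this action is given by $U=\{I_{2n}\}$.
   Context: When bracket relations of a Lie algebra are given in a basis, all brackets of basis vectors not determined by the listed ones through antisymmetry are zero. The Lie algebra $\mathfrak{g}$ is identified with $\mathbb{R}^{2n}$ via the basis $\{e_1,\ldots,e_{2n}\}$. $\Omega(\mathfrak{g})$ denotes the set of nondegenerate alternating bilinear forms ($2$-forms) on the vector space $\mathfrak{g}$ (not necessarily closed). The group $\mathrm{GL}(2n,\mathbb{R})$ acts on $\Omega(\mathfrak{g})$ by $g.\omega(\cdot,\cdot)=\omega(g^{-1}(\cdot),g^{-1}(\cdot))$. $\mathrm{Aut}(\mathfrak{g})$ is the group of Lie algebra automorphisms, and $\mathbb{R}^\times\mathrm{Aut}(\mathfrak{g})=\{c\phi\mid\phi\in\mathrm{Aut}(\mathfrak{g}),\ c\in\mathbb{R}\setminus\{0\}\}\subset\mathrm{GL}(2n,\mathbb{R})$, acting by restriction; $[\omega]$ denotes the orbit of $\omega$ under this group. Let $\{\varepsilon^i\}$ be the dual basis of $\{e_i\}$ and $\omega_0=\varepsilon^1\wedge\varepsilon^{n+1}+\cdots+\varepsilon^n\wedge\varepsilon^{2n}$.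 A subset $U\subset\mathrm{GL}(2n,\mathbb{R})$ is a set of representatives for the action of $\mathbb{R}^\times\mathrm{Aut}(\mathfrak{g})$ on $\Omega(\mathfrak{g})$ if the set of all orbits equals $\{[h.\omega_0]\mid h\in U\}$. *)

(* Defs.v *)
From HB Require Import structures.
From mathcomp Require Import all_boot all_order all_algebra.
From mathcomp Require Import boolp classical_sets reals.
From mathcomp Require Import ring.

Set Implicit Arguments.
Unset Strict Implicit.
Unset Printing Implicit Defensive.

Import Order.TTheory GRing.Theory Num.Theory.
Local Open Scope classical_set_scope.
Local Open Scope ring_scope.

(* MathComp's [bilinear_for] also records the target scaling, whence the two
   scaling operators below: [*:%R] for brackets and [*%R] for scalar forms. *)
Record lieBracket (R : realType) (V : lmodType R) := LieBracket {
  lie_fun :> V -> V -> V;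
  lie_bilinear : bilinear_for *:%R *:%R lie_fun;
  lie_alternating : forall x, lie_fun x x = 0;
  lie_jacobi : forall x y z,
    lie_fun x (lie_fun y z) + lie_fun y (lie_fun z x)
      + lie_fun z (lie_fun x y) = 0
}.

Definition GL (R : realType) (m : nat) : set 'M[R]_m := [set g | g \in unitmx].

Section LieGroups.
Variables (R : realType) (m : nat).

(* Matrices act on column vectors, so [g] stands for the map [x |-> g *m x]. *)
Definition Aut (br : lieBracket 'cV[R]_m) : set 'M[R]_m :=
  [set phi | GL phi /\ forall x y, phi *m br x y = br (phi *m x) (phi *m y)].

Definition RxAut (br : lieBracket 'cV[R]_m) : set 'M[R]_m :=
  [set h | exists c phi, [/\ c != 0, Aut br phi & h = c *: phi]].

Definition Omega : set ('cV[R]_m -> 'cV[R]_m -> R) :=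
  [set w | [/\ bilinear_for *%R *%R w,
               (forall x, w x x = 0)
             & (forall x, (forall y, w x y = 0) -> x = 0)]].

Definition act (g : 'M[R]_m) (w : 'cV[R]_m -> 'cV[R]_m -> R) :
    'cV[R]_m -> 'cV[R]_m -> R :=
  fun x y => w (invmx g *m x) (invmx g *m y).

Definition orbit (H : set 'M[R]_m) (w : 'cV[R]_m -> 'cV[R]_m -> R) :
    set ('cV[R]_m -> 'cV[R]_m -> R) :=
  [set act h w | h in H].

Definition transitive_on_Omega (H : set 'M[R]_m) : Prop :=
  Omega !=set0 /\
  forall w w', Omega w -> Omega w' -> exists2 h, H h & act h w = w'.

Definition basis_vec (i : 'I_m) : 'cV[R]_m := delta_mx i 0.

Definition dual_basis (i : 'I_m) (x : 'cV[R]_m) : R := x i 0.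

Definition wedge (a b : 'cV[R]_m -> R) (x y : 'cV[R]_m) : R :=
  a x * b y - a y * b x.

End LieGroups.

(* The dimension 2n is written [n + n]: the vectors e_1, .., e_n are indexed by
   [lshift n i] and e_(n+1), .., e_(2n) by [rshift n i], for [i : 'I_n]. *)
Definition omega0 (R : realType) (n : nat) (x y : 'cV[R]_(n + n)) : R :=
  \sum_(i < n) wedge (dual_basis (lshift n i)) (dual_basis (rshift n i)) x y.

Definition set_of_representatives (R : realType) (n : nat)
    (H U : set 'M[R]_(n + n)) : Prop :=
  U `<=` @GL R (n + n) /\
  [set orbit H w | w in @Omega R (n + n)]
    = [set orbit H (act h (@omega0 R n)) | h in U].

Section RealHyperbolic.
Variables (R : realType) (m : nat).
Implicit Types x y z : 'cV[R]_m.

(* Indices start at 0, so e_1 is the basis vector whose index has value 0. *)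
Definition RH_struct (i j : 'I_m) : 'cV[R]_m :=
  if (i == 0 :> nat) && (j != 0 :> nat) then basis_vec R j
  else if (i != 0 :> nat) && (j == 0 :> nat) then - basis_vec R i
  else 0.

Definition RH_fun x y : 'cV[R]_m :=
  \sum_i \sum_j (x i 0 * y j 0) *: RH_struct i j.

Lemma RH_fun_basis i j :
  RH_fun (basis_vec R i) (basis_vec R j) = RH_struct i j.
Proof.
rewrite /RH_fun (bigD1 i) //= (bigD1 j) //= !mxE !eqxx mulr1 scale1r.
rewrite big1 ?addr0 => [|k /negPf nkj]; last by rewrite !mxE nkj mulr0 scale0r.
rewrite big1 ?addr0 // => k /negPf nki.
by apply: big1 => l _; rewrite !mxE nki mul0r scale0r.
Qed.

Definition RH_head x : R := \sum_(i < m | i == 0 :> nat) x i 0.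

Lemma RH_headP a x y : RH_head (a *: x + y) = a * RH_head x + RH_head y.
Proof.
rewrite /RH_head big_distrr -big_split /=.
by apply: eq_bigr => i _; rewrite !mxE.
Qed.

Lemma RH_funE x y : RH_fun x y = RH_head x *: y - RH_head y *: x.
Proof.
rewrite {2}(_ : y = \sum_j y j 0 *: basis_vec R j); last first.
  by rewrite {1}[y]matrix_sum_delta; apply: eq_bigr => i _; rewrite big_ord1.
rewrite {3}(_ : x = \sum_j x j 0 *: basis_vec R j); last first.
  by rewrite {1}[x]matrix_sum_delta; apply: eq_bigr => i _; rewrite big_ord1.
rewrite /RH_head 2!scaler_suml [in X in _ - X]big_mkcond [in X in X - _]big_mkcond.
under [X in _ = X - _]eq_bigr do rewrite scaler_sumr.
under [X in _ = _ - X]eq_bigr do rewrite scaler_sumr.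
have H0 (P : bool) (F : 'I_m -> 'cV[R]_m) :
    (if P then \sum_j F j else 0) = \sum_j (if P then F j else 0).
  by case: P => //; rewrite big1.
under [X in _ = X - _]eq_bigr do rewrite H0.
under [X in _ = _ - X]eq_bigr do rewrite H0.
rewrite [X in _ = _ - X]exchange_big /= -sumrB; apply: eq_bigr => i _.
rewrite -sumrB; apply: eq_bigr => j _; rewrite /RH_struct !scalerA.
case: (eqVneq (i : nat) 0%N) => i0; case: (eqVneq (j : nat) 0%N) => j0 /=.
- have -> : i = j by apply: val_inj; rewrite /= i0 j0.
  by rewrite scaler0 [y j 0 * _]mulrC subrr.
- by rewrite subr0.
- by rewrite sub0r scalerN mulrC.
- by rewrite scaler0 subrr.
Qed.

Fact RH_bilinear : bilinear_for *:%R *:%R RH_fun.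
Proof.
split=> u a x y /=; rewrite !RH_funE RH_headP;
by apply/matrixP=> i j; rewrite !mxE; ring.
Qed.

Fact RH_alternating x : RH_fun x x = 0.
Proof. by rewrite RH_funE subrr. Qed.

Fact RH_jacobi x y z :
  RH_fun x (RH_fun y z) + RH_fun y (RH_fun z x) + RH_fun z (RH_fun x y) = 0.
Proof.
have head0 u v : RH_head (RH_fun u v) = 0.
  have headZ a w : RH_head (a *: w) = a * RH_head w.
    by rewrite /RH_head big_distrr; apply: eq_bigr => i _; rewrite mxE.
  by rewrite RH_funE -scaleNr RH_headP headZ; ring.
rewrite !(RH_funE _ (RH_fun _ _)) !head0 !RH_funE.
by apply/matrixP=> i j; rewrite !mxE; ring.
Qed.

Definition gRH : lieBracket 'cV[R]_m :=
  LieBracket RH_bilinear RH_alternating RH_jacobi.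

End RealHyperbolic.

(* Main.v *)
(* In the Lie algebra at hand [x, y] = h(x) y - h(y) x, where h is the first
   coordinate, so every invertible matrix preserving h is an automorphism.
   Given a nondegenerate 2-form w, let v be the vector with w(-, v) = h. Any
   symplectic basis of w whose (n+1)-st vector is v carries omega0 to w, and it
   preserves h since h(S x) = w(S x, v) = omega0(x, e_(n+1)) = h(x). *)

Require Import Defs.
From mathcomp Require Import all_boot all_order all_algebra.
From mathcomp Require Import boolp classical_sets reals.
From mathcomp Require Import fingroup perm.

Set Implicit Arguments.
Unset Strict Implicit.
Unset Printing Implicit Defensive.

Import Order.TTheory GRing.Theory Num.Theory.
Local Open Scope classical_set_scope.
Local Open Scope ring_scope.

(** * Symplectic bases of an invertible skew matrix *)

Section SymplecticBasis.
Context {F : numFieldType} {m : nat}.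
Implicit Types (A : 'M[F]_m) (x y v : 'cV[F]_m).

(** The value is a 1 by 1 matrix, equal to its own transpose and, by skewness, to minus it; 2 is
    invertible in [F]. *)
Lemma skew_form_alt A x : A^T = - A -> x^T *m A *m x = 0.
Proof.
move=> skA.
have skew0 (s : 'M[F]_1) : s^T = - s -> s = 0.
  move/matrixP/(_ 0 0)/eqP; rewrite !mxE -subr_eq0 opprK -mulr2n mulrn_eq0 /=.
  by move=> /eqP s0; apply/matrixP => i j; rewrite !ord1 s0 mxE.
by apply: skew0; rewrite !trmx_mul trmxK skA mulNmx mulmxN mulmxA.
Qed.

Definition symplectic_system A k (P Q : 'M[F]_(m, k)) : Prop :=
  [/\ P^T *m A *m P = 0, Q^T *m A *m Q = 0 & P^T *m A *m Q = 1%:M].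

Lemma tr_skew_form A k l (P : 'M[F]_(m, k)) (Q : 'M[F]_(m, l)) :
  A^T = - A -> (P^T *m A *m Q)^T = - (Q^T *m A *m P).
Proof. by move=> skA; rewrite !trmx_mul trmxK skA mulNmx mulmxN mulmxA. Qed.

(** The row [x^T *m A] is nonzero, hence of full row rank, and its pseudo-inverse is a right
    inverse. *)
Lemma nonzero_pairing_1 A x : A \in unitmx -> x != 0 ->
  exists y, x^T *m A *m y = 1%:M.
Proof.
move=> uA x0; exists (pinvmx (x^T *m A)); apply: mulmxVp.
rewrite /row_free rank_rV; have -> // : x^T *m A != 0.
apply: contraNneq x0 => xA0; rewrite -[x]trmxK -[x^T](mulmxK uA) xA0.
by rewrite mul0mx trmx0.
Qed.

(** Symplectic Gram-Schmidt: take a nonzero vector [x] orthogonal to the columns of [P] and [Q],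
    then a partner for it, corrected to be orthogonal to them as well. *)
Lemma symplectic_system_extend A k (P Q : 'M[F]_(m, k)) :
  A^T = - A -> A \in unitmx -> (k + k < m)%N -> symplectic_system A P Q ->
  exists x y, symplectic_system A (row_mx x P) (row_mx y Q).
Proof.
move=> skA uA ltkm [PP QQ PQ].
have QP : Q^T *m A *m P = - 1%:M.
  by rewrite -[LHS]opprK -tr_skew_form // PQ trmx1.
pose C := A *m row_mx P Q.
(* Such an [x] exists by dimension: [C] has [m] rows but rank at most [k + k]. *)
have kC0 : kermx C != 0.
  rewrite -mxrank_eq0 mxrank_ker subn_eq0 -ltnNge.
  exact: leq_ltn_trans (rank_leq_col C) ltkm.
pose x := (nz_row (kermx C))^T.
have x0 : x != 0 by rewrite trmx_eq0 nz_row_eq0.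
have : x^T *m C = 0 by apply/sub_kermxP; rewrite trmxK nz_row_sub.
rewrite mulmxA mul_mx_row -[0]row_mx0 => /eq_row_mx [xP xQ].
have [z xz] := nonzero_pairing_1 uA x0.
(* Remove from [z] its components along [P] and [Q]; the signs come from [PQ] and [QP]. The pairing
   with [x] is unchanged by [xP] and [xQ]. *)
pose y := z + P *m (Q^T *m A *m z) - Q *m (P^T *m A *m z).
have xy : x^T *m A *m y = 1%:M.
  rewrite mulmxBr mulmxDr !(mulmxA _ P) !(mulmxA _ Q).
  by rewrite xP xQ !mul0mx addr0 subr0.
have Py : P^T *m A *m y = 0.
  rewrite mulmxBr mulmxDr !(mulmxA _ P) !(mulmxA _ Q).
  by rewrite PP PQ mul0mx mul1mx addr0 subrr.
have Qy : Q^T *m A *m y = 0.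
  rewrite mulmxBr mulmxDr !(mulmxA _ P) !(mulmxA _ Q).
  by rewrite QP QQ mul0mx mulNmx mul1mx subrr subr0.
have swap k1 l (U : 'M[F]_(m, k1)) (V : 'M[F]_(m, l)) :
    U^T *m A *m V = 0 -> V^T *m A *m U = 0.
  by move=> UV; rewrite -[LHS]opprK -tr_skew_form // UV trmx0 oppr0.
exists x, y; split; rewrite tr_row_mx mul_col_mx mul_col_row.
- by rewrite skew_form_alt // xP (swap _ _ _ _ xP) PP block_mx0.
- by rewrite skew_form_alt // Qy (swap _ _ _ _ Qy) QQ block_mx0.
- by rewrite xy xQ Py PQ -scalar_mx_block.
Qed.

(** Induction on the number of pairs, starting from a pair that contains [v]. Each extension adds
    columns on the left and so shifts [v], whence the unspecified index. *)
Lemma symplectic_system_exists A v j :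
  A^T = - A -> A \in unitmx -> v != 0 -> (j.+1 + j.+1 <= m)%N ->
  exists P Q : 'M[F]_(m, j.+1),
    symplectic_system A P Q /\ exists i, Q *m delta_mx i 0 = v.
Proof.
move=> skA uA v0; elim: j => [_|j IHj lejm].
  have [u vu] := nonzero_pairing_1 uA v0.
  (* The sign puts [v] in second place: [vu] pairs [v] with [u] to 1, so [- u] pairs with [v] to
     1. *)
  exists (- u), v; split; first split; rewrite ?skew_form_alt //.
    by rewrite linearN !mulNmx -tr_skew_form // vu trmx1.
  exists 0; rewrite -[RHS]mulmx1; congr (_ *m _).
  by apply/matrixP => i k; rewrite !ord1 !mxE.
have ltjm : (j.+1 + j.+1 < m)%N.
  by apply: leq_trans lejm; rewrite -addnS leq_add2r leqnSn.
have [P [Q [sPQ [i Qi]]]] := IHj (ltnW ltjm).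
have [x [y sPQ']] := symplectic_system_extend skA uA ltjm sPQ.
exists (row_mx x P), (row_mx y Q); split=> //; exists (rshift 1 i).
by rewrite (@delta_mx_dshift _ 1 j.+1) (@mul_row_col _ m 1 j.+1) mulmx0 add0r.
Qed.

End SymplecticBasis.

(** The Gram matrix of [omega0] in the standard basis. *)
Definition symplectic_mx (F : numFieldType) n : 'M[F]_(n + n) :=
  block_mx 0 1%:M (- 1%:M) 0.

Lemma symplectic_mx_unit (F : numFieldType) n : symplectic_mx F n \in unitmx.
Proof.
have /mulmx1_unit[] // : symplectic_mx F n *m - symplectic_mx F n = 1%:M.
rewrite mulmxN mulmx_block !mul0mx !mulmx0 !mul1mx mulmx1 !addr0 !add0r.
by rewrite opp_block_mx !oppr0 opprK -scalar_mx_block.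
Qed.

Lemma symplectic_basis_exists (F : numFieldType) n
    (A : 'M[F]_(n.+1 + n.+1)) (v : 'cV[F]_(n.+1 + n.+1)) :
  A^T = - A -> A \in unitmx -> v != 0 ->
  exists2 S : 'M[F]_(n.+1 + n.+1), S^T *m A *m S = symplectic_mx F n.+1
    & S *m delta_mx (rshift n.+1 ord0) 0 = v.
Proof.
move=> skA uA v0.
have [P [Q [[PP QQ PQ] [i Qi]]]] :=
  symplectic_system_exists skA uA v0 (leqnn _).
have QP : Q^T *m A *m P = - 1%:M.
  by rewrite -[LHS]opprK -tr_skew_form // PQ trmx1.
(* Swapping columns 0 and [i] in both [P] and [Q] brings [v] to the front of [Q]; the relations
   survive because [t] is orthogonal. *)
pose t : 'M[F]_n.+1 := tperm_mx ord0 i.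
have tt : t^T *m t = 1%:M.
  by rewrite tr_tperm_mx -perm_mxM tperm2 perm_mx1.
have conj (U V : 'M[F]_(n.+1 + n.+1, n.+1)) :
    (U *m t)^T *m A *m (V *m t) = t^T *m (U^T *m A *m V) *m t.
  by rewrite trmx_mul !mulmxA.
exists (row_mx (P *m t) (Q *m t)).
  rewrite tr_row_mx mul_col_mx mul_col_row !conj PP QQ PQ QP.
  by rewrite mulmxN mulNmx mulmx1 !mulmx0 !mul0mx tt.
rewrite delta_mx_dshift mul_row_col mulmx0 add0r -mulmxA -Qi; congr (_ *m _).
rewrite -colE; apply/colP => l; rewrite !mxE !eqxx !andbT.
by rewrite -(inj_eq (@perm_inj _ (tperm ord0 i)) l i) tpermR.
Qed.

(** * Two-forms as Gram matrices, and the group action *)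

Section Omega.
Variables (R : realType) (m : nat).
Implicit Types (w : 'cV[R]_m -> 'cV[R]_m -> R) (x y : 'cV[R]_m).

Definition gram_mx w : 'M[R]_m :=
  \matrix_(i, j) w (basis_vec R i) (basis_vec R j).

Lemma linear_basis_expand (f : 'cV[R]_m -> R) x :
  linear_for *%R f -> f x = \sum_i x i 0 * f (basis_vec R i).
Proof.
move=> lf; have f0 : f 0 = 0.
  by have := lf (-1) 0 0; rewrite scaler0 addr0 mulN1r addNr.
rewrite {1}[x]matrix_sum_delta.
under eq_bigr do rewrite big_ord1.
by apply: (big_rec2 (fun a b => f a = b)) => // i a b _ <-; rewrite lf.
Qed.

Lemma gram_mxE w x y : bilinear_for *%R *%R w ->
  w x y = (x^T *m gram_mx w *m y) 0 0.
Proof.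
move=> [wl wr]; rewrite (linear_basis_expand x (wl y)) -mulmxA mxE.
apply: eq_bigr => i _; rewrite mxE (linear_basis_expand y (wr _)) mxE.
by congr (_ * _); apply: eq_bigr => j _; rewrite mxE mulrC.
Qed.

Lemma gram_mx_skew w : Omega w -> (gram_mx w)^T = - gram_mx w.
Proof.
move=> [[wl wr] w0 _]; apply/matrixP => i j; rewrite !mxE.
set x := basis_vec R i; set y := basis_vec R j.
(* Polarization; the factor 1 gives the sum the shape in which linearity is stated. *)
have := w0 (1 *: x + y).
rewrite (wl _ 1 x y) !(wr _ 1 x y) /= !w0 !mul1r add0r addr0.
by rewrite addrC => /eqP; rewrite addr_eq0 => /eqP.
Qed.

(** A row in the left kernel of the Gram matrix is the transpose of a vector in the radical of
    [w]. *)
Lemma gram_mx_unit w : Omega w -> gram_mx w \in unitmx.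
Proof.
move=> [wb _ wnd]; rewrite -row_free_unit -kermx_eq0.
apply/rowV0P => u /sub_kermxP uw0; apply/trmx_inj; rewrite trmx0.
by apply: wnd => y; rewrite gram_mxE // trmxK uw0 mul0mx mxE.
Qed.

Lemma mx_form_Omega (A : 'M[R]_m) : A^T = - A -> A \in unitmx ->
  Omega (fun x y => (x^T *m A *m y) 0 0).
Proof.
move=> skA uA; split; first split.
- by move=> u a x y /=; rewrite linearP /= !mulmxDl -!scalemxAl !mxE.
- by move=> u a x y /=; rewrite mulmxDr -scalemxAr !mxE.
- by move=> x; rewrite skew_form_alt // mxE.
- move=> x x0; apply/eqP/negP => /negP nx.
  have [y xy] := nonzero_pairing_1 uA nx.
  by have /eqP := x0 y; rewrite xy !mxE oner_eq0.
Qed.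

Lemma act_Omega (g : 'M[R]_m) w : g \in unitmx -> Omega w -> Omega (act g w).
Proof.
move=> ug [[wl wr] w0 wnd]; split; first split.
- by move=> u a x y; rewrite /act mulmxDr -scalemxAr wl.
- by move=> u a x y; rewrite /act mulmxDr -scalemxAr wr.
- by move=> x; apply: w0.
- move=> x x0; rewrite -[x](mulKVmx ug) (wnd (invmx g *m x)) ?mulmx0 // => y.
  by have := x0 (g *m y); rewrite /act mulKmx.
Qed.

Lemma act1 w : act 1%:M w = w.
Proof. by apply/funext => x; apply/funext => y; rewrite /act invmx1 !mul1mx. Qed.

Lemma RxAut_unit (br : lieBracket 'cV[R]_m) h : RxAut br h -> h \in unitmx.
Proof.
by move=> [c [phi [c0 [uphi _] ->]]]; rewrite unitmxZ ?unitfE.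
Qed.

(** Reduces the claim on representatives to transitivity: there is a single orbit. *)
Lemma transitive_orbit (br : lieBracket 'cV[R]_m) w :
  transitive_on_Omega (RxAut br) -> Omega w ->
  Defs.orbit (RxAut br) w = @Omega R m.
Proof.
move=> [_ tr] Ow; apply/seteqP; split => [_ [h Hh <-]|w' Ow'].
  exact: act_Omega (RxAut_unit Hh) Ow.
exact: tr.
Qed.

Lemma RH_head_preserving_RxAut (h : 'M[R]_m) : h \in unitmx ->
  (forall x, RH_head (h *m x) = RH_head x) -> RxAut (gRH R m) h.
Proof.
move=> uh hh; exists 1, h; split; rewrite ?oner_neq0 ?scale1r //; split=> //.
by move=> x y; rewrite /= !RH_funE !hh mulmxBr -!scalemxAr.
Qed.

End Omega.

(** * The standard form and bases adapted to the first coordinate *)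

Lemma omega0E (R : realType) n (x y : 'cV[R]_(n + n)) :
  omega0 x y = (x^T *m symplectic_mx R n *m y) 0 0.
Proof.
rewrite -[in RHS](vsubmxK x) -[in RHS](vsubmxK y) tr_col_mx mul_row_block.
rewrite !mulmx0 mulmxN !mulmx1 add0r addr0 mul_row_col mulNmx.
rewrite addrC !mxE -sumrB; apply: eq_bigr => i _; rewrite !mxE.
by rewrite /wedge /dual_basis [y _ _ * _]mulrC.
Qed.

Lemma symplectic_mx_skew (F : numFieldType) n :
  (symplectic_mx F n)^T = - symplectic_mx F n.
Proof.
by rewrite tr_block_mx opp_block_mx !trmx0 linearN /= trmx1 !oppr0 opprK.
Qed.

Lemma omega0_Omega (R : realType) n : Omega (@omega0 R n).
Proof.
have -> : @omega0 R n = fun x y => (x^T *m symplectic_mx R n *m y) 0 0.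
  by apply/funext => x; apply/funext => y; apply: omega0E.
exact: mx_form_Omega (symplectic_mx_skew _ _) (symplectic_mx_unit _ _).
Qed.

Lemma RH_headE (R : realType) n (x : 'cV[R]_(n.+1 + n.+1)) :
  RH_head x = x (lshift n.+1 ord0) 0.
Proof. by rewrite /RH_head (big_pred1 (lshift n.+1 ord0)). Qed.

Lemma omega0_dshift (R : realType) n (x : 'cV[R]_(n.+1 + n.+1)) :
  omega0 x (basis_vec R (rshift n.+1 ord0)) = RH_head x.
Proof.
rewrite /omega0 (bigD1 ord0) //= big1 => [|i i0].
  rewrite /wedge /dual_basis /basis_vec RH_headE !mxE eqxx eq_lrshift.
  by rewrite mulr1 mul0r subr0 addr0.
rewrite /wedge /dual_basis /basis_vec !mxE eq_lrshift eq_rshift (negPf i0).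
by rewrite mulr0 mul0r subr0.
Qed.

Lemma adapted_symplectic_basis (R : realType) n w :
  @Omega R (n.+1 + n.+1) w ->
  exists S, [/\ S \in unitmx, forall x y, w (S *m x) (S *m y) = omega0 x y
               & forall x, RH_head (S *m x) = RH_head x].
Proof.
move=> Ow; have [wb _ _] := Ow; have uA := gram_mx_unit Ow.
set A := gram_mx w in uA *.
pose e : 'cV[R]_(n.+1 + n.+1) := basis_vec R (lshift n.+1 ord0).
(* Since [A *m v] is e_1, pairing any [x] with [v] reads off its first coordinate. *)
pose v := invmx A *m e.
have wv x : w x v = RH_head x.
  rewrite gram_mxE // -/A -mulmxA mulKVmx // RH_headE /e /basis_vec -colE.
  by rewrite !mxE.
(* [v] pairs with e_1 to 1. *)
have v0 : v != 0.
  apply/eqP => v0; have := wv e; rewrite v0 gram_mxE // mulmx0 RH_headE !mxE.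
  by rewrite !eqxx => /eqP; rewrite eq_sym oner_eq0.
have [S SAS Sv] := symplectic_basis_exists (gram_mx_skew Ow) uA v0.
have wS x y : w (S *m x) (S *m y) = omega0 x y.
  by rewrite gram_mxE // omega0E -SAS trmx_mul !mulmxA.
exists S; split=> //.
  have := symplectic_mx_unit R n.+1.
  by rewrite -SAS unitmx_mul => /andP[].
by move=> x; rewrite -wv -Sv wS omega0_dshift.
Qed.

Theorem proposition5p1 (R : realType) (n : nat) (hn : (1 <= n)%N) :
  transitive_on_Omega (RxAut (gRH R (n + n))) /\
  set_of_representatives (RxAut (gRH R (n + n))) [set 1%:M].
Proof.
have tr : transitive_on_Omega (RxAut (gRH R (n + n))).
  split; first by exists (@omega0 R n); apply: omega0_Omega.
  case: n hn => // n _ w w' Ow Ow'.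
  have [S [uS wS hS]] := adapted_symplectic_basis Ow.
  have [T [uT wT hT]] := adapted_symplectic_basis Ow'.
  (* This matrix sends the basis [S] adapted to [w] to the basis [T] adapted to [w']. Both preserve
     the first coordinate, hence so does it. *)
  exists (T *m invmx S).
    apply: RH_head_preserving_RxAut => [|x].
      by rewrite unitmx_mul uT unitmx_inv.
    by rewrite -mulmxA hT -hS mulKVmx.
  apply/funext => x; apply/funext => y.
  have inv z : invmx (T *m invmx S) *m z = S *m (invmx T *m z).
    apply: (canLR (mulKmx _)); first by rewrite unitmx_mul uT unitmx_inv.
    by rewrite -mulmxA mulKmx // mulKVmx.
  by rewrite /act !inv wS -wT !mulKVmx.
split=> //; split; first by move=> _ ->; apply: unitmx1.
apply/seteqP; split => [_ [w Ow <-]|_ [_ -> <-]].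
  (* The orbits of [w] and of [omega0] are both all of [Omega]. *)
  by exists 1%:M => //; rewrite act1 !transitive_orbit //; apply: omega0_Omega.
by exists (@omega0 R n); [apply: omega0_Omega | rewrite act1].
Qed.
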